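(* Let $n$ be a positive integer. The number of homeomorphism classes of small covers over the $n$-cube $I^n$ is less than or equal to the number of acyclic digraphs with $n$ unlabeled nodes.
   Context: $\mathbb{Z}_2$ denotes the group (field) with two elements. Digraphs: a digraph on $n$ nodes has at most one edge directed from vertex $i$ to vertex $j$, for each ordered pair of vertices $(i,j)$. It is acyclic if it has no directed cycle of any length (in particular no loops and no directed 2-cycles). Acyclic digraphs with $n$ unlabeled nodes are isomorphism classes of acyclic digraphs on $n$ nodes, i.e. acyclic digraphs up to relabeling of the nodes. Small covers: let $P$ be a simple convex polytope of dimension $n$ (here $P=I^n$). The standard action of $\mathbb{Z}_2^n$ on $\mathbb{R}^n$ is by sign changes of the coordinates; a $\mathbb{Z}_2^n$-action on an $n$-manifold is locally standard if it is locally isomorphic, up to an automorphism of $\mathbb{Z}_2^n$, to the standard action. A small cover over $P$ is a smooth closed manifold $M$ of dimension $n$ with a locally standard $\mathbb{Z}_2^n$-action whose orbit space is $P$ (identified as a manifold with corners). Homeomorphism classes are classes of the underlying manifolds up to homeomorphism, with no equivariance required. *)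

(* Defs.v *)
From HB Require Import structures.
From mathcomp Require Import all_boot all_order all_fingroup all_algebra.
From mathcomp Require Import all_classical all_reals all_analysis.

Set Implicit Arguments.
Unset Strict Implicit.
Unset Printing Implicit Defensive.

Import Order.TTheory GRing.Theory Num.Theory.
Import numFieldNormedType.Exports.

Local Open Scope classical_set_scope.
Local Open Scope ring_scope.

(* A digraph on n labeled nodes is its set of edges. *)
Definition digraph (n : nat) := {set 'I_n * 'I_n}.

(* [ucycle] ranges over simple directed cycles, loops and 2-cycles included. *)
Definition acyclic (n : nat) (E : digraph n) : Prop :=
  forall c : seq 'I_n, ucycle (fun i j => (i, j) \in E) c -> c = [::].

Definition digraph_iso (n : nat) : rel (digraph n) := fun E F =>
  [exists s : {perm 'I_n}, forall i, forall j,
     ((i, j) \in E) == ((s i, s j) \in F)].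

Definition num_unlabeled_acyclic_digraphs (n : nat) : nat :=
  #|equivalence_partition (@digraph_iso n)
      (finset (fun E : digraph n => `[< acyclic E >]))|.

Definition homeomorphic (M N : topologicalType) : Prop :=
  exists (f : M -> N) (g : N -> M),
    [/\ cancel f g, cancel g f, continuous f & continuous g].

(* All partial derivatives of order at most k exist and are continuous on the
   (open) set U. *)
Fixpoint Ck_on (R : realType) (n k : nat) (U : set 'rV[R]_n)
    (f : 'rV[R]_n -> R) : Prop :=
  {in U, continuous f} /\
  if k is k'.+1 then
    forall i : 'I_n,
      {in U, forall v, derivable f v (delta_mx 0 i)} /\
      Ck_on k' U ('D_(delta_mx 0 i) f)
  else True.

Definition smooth_on (R : realType) (m n : nat) (U : set 'rV[R]_m)
    (f : 'rV[R]_m -> 'rV[R]_n) : Prop :=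
  forall (j : 'I_n) (k : nat), Ck_on k U (fun v => f v 0 j).

(* A homeomorphism from an open subset of M onto an open subset of R^n; the
   values of [chart_fun] and [chart_inv] outside of these sets are irrelevant. *)
Record chart (R : realType) (n : nat) (M : topologicalType) := Chart {
  chart_dom : set M;
  chart_cod : set 'rV[R]_n;
  chart_fun : M -> 'rV[R]_n;
  chart_inv : 'rV[R]_n -> M;
  chart_dom_open : open chart_dom;
  chart_cod_open : open chart_cod;
  chart_funS : forall x, chart_dom x -> chart_cod (chart_fun x);
  chart_invS : forall v, chart_cod v -> chart_dom (chart_inv v);
  chart_funK : {in chart_dom, cancel chart_fun chart_inv};
  chart_invK : {in chart_cod, cancel chart_inv chart_fun};
  chart_fun_continuous : {in chart_dom, continuous chart_fun};
  chart_inv_continuous : {in chart_cod, continuous chart_inv}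
}.

(* The local expression of f in the charts c and c' is smooth. *)
Definition smooth_in_charts (R : realType) (n : nat) (M : topologicalType)
    (c c' : chart R n M) (f : M -> M) : Prop :=
  smooth_on
    [set v | chart_cod c v /\ chart_dom c' (f (chart_inv c v))]
    (fun v => chart_fun c' (f (chart_inv c v))).

Definition smooth_atlas (R : realType) (n : nat) (M : topologicalType)
    (A : set (chart R n M)) : Prop :=
  (forall x, exists2 c, A c & chart_dom c x) /\
  (forall c c', A c -> A c' -> smooth_in_charts c c' id).

(* c belongs to the maximal atlas generated by A. *)
Definition smooth_chart (R : realType) (n : nat) (M : topologicalType)
    (A : set (chart R n M)) (c : chart R n M) : Prop :=
  forall c', A c' -> smooth_in_charts c c' id /\ smooth_in_charts c' c id.

Definition smooth_map (R : realType) (n : nat) (M : topologicalType)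
    (A : set (chart R n M)) (f : M -> M) : Prop :=
  continuous f /\ forall c c', A c -> A c' -> smooth_in_charts c c' f.

(* The group Z_2^n is the additive group of 'rV['F_2]_n. *)
Definition sign_action (R : realType) (n : nat) (g : 'rV['F_2]_n)
    (v : 'rV[R]_n) : 'rV[R]_n :=
  \row_i (if g 0 i == 0 then v 0 i else - v 0 i).

(* The domain of c is invariant, and c is equivariant for the standard action
   up to an automorphism of Z_2^n. *)
Definition equivariant_chart (R : realType) (n : nat) (M : topologicalType)
    (act : 'rV['F_2]_n -> M -> M) (c : chart R n M) : Prop :=
  exists2 theta : {additive 'rV['F_2]_n -> 'rV['F_2]_n}, bijective theta &
    forall g x, chart_dom c x ->
      chart_dom c (act g x) /\
      chart_fun c (act g x) = sign_action (theta g) (chart_fun c x).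

Definition cube (R : realType) (n : nat) : set 'rV[R]_n :=
  [set v | forall i, 0 <= v 0 i <= 1].
Arguments cube : clear implicits.

(* Codimension of the open face of the cube that contains v. *)
Definition cube_depth (R : realType) (n : nat) (v : 'rV[R]_n) : nat :=
  #|finset (fun i : 'I_n => (v 0 i == 0) || (v 0 i == 1))|.

(* The absolute values of the coordinates identify the orbit space of the
   standard action with the orthant R_{>=0}^n; this is the codimension of the
   face of the orthant whose relative interior contains the orbit of v. *)
Definition orthant_depth (R : realType) (n : nat) (v : 'rV[R]_n) : nat :=
  #|finset (fun i : 'I_n => v 0 i == 0)|.

(* The orbit space is given through its projection sc_proj to the cube: a
   topological quotient map onto the cube whose fibers are the orbits, such
   that the induced homeomorphism from the orbit space to the cube is one of
   manifolds with corners, i.e., preserves the codimension of faces.  The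
   corner structure of the orbit space is the one induced by the equivariant
   charts. *)
Record small_cover (R : realType) (n : nat) := SmallCover {
  sc_space :> topologicalType;
  sc_atlas : set (chart R n sc_space);
  sc_act : 'rV['F_2]_n -> sc_space -> sc_space;
  sc_proj : sc_space -> 'rV[R]_n;
  sc_hausdorff : hausdorff_space sc_space;
  sc_second_countable : @second_countable sc_space;
  sc_compact : compact [set: sc_space];
  sc_atlas_smooth : smooth_atlas sc_atlas;
  sc_act0 : forall x, sc_act 0 x = x;
  sc_actD : forall g h x, sc_act (g + h) x = sc_act g (sc_act h x);
  sc_act_smooth : forall g, smooth_map sc_atlas (sc_act g);
  sc_locally_standard : forall x, exists c,
    [/\ smooth_chart sc_atlas c, equivariant_chart sc_act c & chart_dom c x];
  sc_proj_range : range sc_proj = cube R n;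
  sc_proj_quotient : forall B, B `<=` cube R n ->
    (open (sc_proj @^-1` B) <-> exists2 V, open V & B = V `&` cube R n);
  sc_proj_fiber : forall x y,
    sc_proj x = sc_proj y <-> exists g, y = sc_act g x;
  sc_proj_corners : forall c x, smooth_chart sc_atlas c ->
    equivariant_chart sc_act c -> chart_dom c x ->
    cube_depth (sc_proj x) = orthant_depth (chart_fun c x)
}.

(* Predicates instead of [set]: universe levels do not allow [set] over a type
   of topological spaces. *)
Definition homeo_class (R : realType) (n : nat) (M : small_cover R n) :
    small_cover R n -> Prop :=
  fun N => homeomorphic M N.

Definition homeo_classes (R : realType) (n : nat) : Type :=
  {C : small_cover R n -> Prop | exists M, C = homeo_class M}.

(* Main.v *)
Require Import Defs.
From mathcomp Require Import all_boot all_order all_fingroup all_algebra.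
From mathcomp Require Import all_classical all_reals all_analysis.
From mathcomp Require Import ring lra.

Set Implicit Arguments.
Unset Strict Implicit.
Unset Printing Implicit Defensive.

Import Order.TTheory GRing.Theory Num.Theory.
Import numFieldNormedType.Exports.

Local Open Scope classical_set_scope.
Local Open Scope ring_scope.

(** A small cover M over the cube is determined, up to homeomorphism, by the
    isotropy groups of its points, and these are encoded by an acyclic digraph.

    The orbit map has a global continuous section s ([global_section]): charts
    give local sections, two sections over a convex set differ by a constant
    element of the group, and the cube can be filled by small boxes glued one
    wall at a time.  Every point of M then has the form g . s v, and two such
    expressions agree exactly when they have the same v and their group elements
    differ by an element of the isotropy group of s v.

    Over the interior of a facet of the cube the isotropy group has order two,
    and by the same constancy argument it has a generator that depends only on
    the facet; this is the characteristic function.  In a chart one sees that the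
    isotropy group at s v is generated by the values of the characteristic
    function on the facets through v ([isotropy_ind]).  At a vertex the isotropy
    group is everything, so the n values on the facets through a vertex form a
    basis of Z_2^n ([vertex_matrix_unit]).

    Expressing the values on the facets opposite to the origin in the basis given
    by the facets through the origin yields a matrix A over F_2, and the basis
    property at all vertices says that all principal minors of A are nonzero.  So
    A has ones on the diagonal, and its off-diagonal entries form a digraph.  On
    a shortest directed cycle the principal submatrix would have exactly two
    nonzero entries in each column, hence would be singular; therefore the
    digraph is acyclic ([matrix_digraph_acyclic]).

    Finally, an isomorphism between the digraphs of M and N permutes the
    coordinates of the cube and, through the two bases, gives an automorphism
    theta of Z_2^n that respects isotropy groups.  Then g . s_M v |-> theta g .
    s_N (phi v) is a homeomorphism ([coded_by_homeomorphic]).  Assigning to a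
    class the isomorphism class of the digraph of one of its members is therefore
    injective. *)

(** * Homeomorphism classes *)

Lemma homeomorphic_sym M N : homeomorphic M N -> homeomorphic N M.
Proof. by case=> f [g [*]]; exists g, f. Qed.

Lemma homeomorphic_trans M N P :
  homeomorphic M N -> homeomorphic N P -> homeomorphic M P.
Proof.
case=> f [g [fK gK fc gc]] [h [k [hK kK hc kc]]].
exists (h \o f), (g \o k); split.
- exact: can_comp hK fK.
- exact: can_comp gK kK.
- by move=> x; apply: continuous_comp; [exact: fc|exact: hc].
- by move=> x; apply: continuous_comp; [exact: kc|exact: gc].
Qed.

Lemma homeo_class_eq (R : realType) n (M N : small_cover R n) :
  homeomorphic M N -> homeo_class M = homeo_class N.
Proof.
move=> h; apply: funext => P; apply: propext; split.
  by apply: homeomorphic_trans; apply: homeomorphic_sym.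
exact: homeomorphic_trans.
Qed.

(** * Vectors over F_2 as subsets *)

Lemma F2_neq0 (x : 'F_2) : x != 0 -> x = 1.
Proof. by case: x => [[|[|m]] lt_m] // _; apply: val_inj. Qed.

Lemma F2row_addrr n (g : 'rV['F_2]_n) : g + g = 0.
Proof.
apply/rowP => i; rewrite !mxE; have [->|/F2_neq0->] := eqVneq (g 0 i) 0.
  by rewrite addr0.
exact: val_inj.
Qed.

Definition indicator_row n (A : {set 'I_n}) : 'rV['F_2]_n :=
  \row_i (i \in A)%:R.

Definition row_support n (g : 'rV['F_2]_n) : {set 'I_n} :=
  [set i | g 0 i != 0]%SET.

Lemma indicator_rowK n : cancel (@indicator_row n) (@row_support n).
Proof.
by move=> A; apply/setP => i; rewrite inE mxE; case: (i \in A).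
Qed.

Lemma row_supportK n : cancel (@row_support n) (@indicator_row n).
Proof.
move=> g; apply/rowP => i; rewrite mxE inE.
by have [->|/F2_neq0->] := eqVneq (g 0 i) 0.
Qed.

Lemma indicator_row_sum n (A : {set 'I_n}) :
  indicator_row A = \sum_(j in A) indicator_row [set j]%SET.
Proof.
apply/rowP => i; rewrite summxE mxE; have [iA|iA] := boolP (i \in A).
  rewrite (bigD1 i) //= mxE set11 big1 ?addr0 // => j /andP[_ ji].
  by rewrite mxE inE eq_sym (negPf ji).
rewrite big1 // => j jA; rewrite mxE inE; case: eqVneq => // ij.
by move: iA; rewrite ij jA.
Qed.

Lemma rows_supported_on n (Z : {set 'I_n}) :
  [set g | row_support g \subset Z]%SET =
  [set indicator_row A | A in powerset Z]%SET.
Proof.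
apply/setP => g; rewrite inE; apply/idP/imsetP => [gZ|[A + ->]].
  by exists (row_support g); rewrite ?row_supportK // powersetE.
by rewrite indicator_rowK powersetE.
Qed.

Lemma card_rows_supported_on n (Z : {set 'I_n}) :
  #|[set g | row_support g \subset Z]%SET| = (2 ^ #|Z|)%N.
Proof.
rewrite rows_supported_on card_imset ?card_powerset //.
exact: can_inj (@indicator_rowK n).
Qed.

(** * Orbits and isotropy groups *)

Section Isotropy.
Variables (R : realType) (n : nat) (M : small_cover R n).
Implicit Types (x y : M) (g h : 'rV['F_2]_n).
Local Notation act := (@sc_act R n M).
Local Notation proj := (@sc_proj R n M).

Lemma proj_cube x : cube R n (proj x).
Proof. by rewrite -(sc_proj_range M); exists x. Qed.

Lemma proj_surj v : cube R n v -> exists x : M, proj x = v.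
Proof. by rewrite -(sc_proj_range M) => -[x _ <-]; exists x. Qed.

Lemma act_continuous g : continuous (act g).
Proof. by have [] := @sc_act_smooth R n M g. Qed.

Lemma actK g : involutive (act g).
Proof. by move=> x; rewrite -sc_actD F2row_addrr sc_act0. Qed.

Lemma actC g h x : act g (act h x) = act h (act g x).
Proof. by rewrite -!sc_actD addrC. Qed.

Lemma proj_act g x : proj (act g x) = proj x.
Proof. by apply/esym/sc_proj_fiber; exists g. Qed.

Lemma proj_continuous : continuous proj.
Proof.
apply/continuousP => V oV.
have -> : proj @^-1` V = proj @^-1` (V `&` cube R n).
  by apply/seteqP; split=> x //= => [Vx|[]//]; split=> //; apply: proj_cube.
by apply/sc_proj_quotient; [move=> ? []|exists V].
Qed.

Lemma proj_open (O : set M) : open O ->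
  exists2 V, open V & proj @` O = V `&` cube R n.
Proof.
move=> oO; have sub : proj @` O `<=` cube R n.
  by move=> _ [x _ <-]; apply: proj_cube.
apply: (iffLR (sc_proj_quotient M sub)).
have -> : proj @^-1` (proj @` O) = \bigcup_g (act g @^-1` O).
  apply/seteqP; split=> [x [y Oy /sc_proj_fiber[g xE]]|x [g _ Ogx]].
    by exists g => //=; rewrite xE actK.
  by exists (act g x) => //; rewrite proj_act.
apply: bigcup_open => g _; apply: open_comp => // x _; exact: act_continuous.
Qed.

Definition isotropy x : {set 'rV['F_2]_n} := [set g | act g x == x]%SET.

Lemma isotropy_proj x y : proj x = proj y -> isotropy x = isotropy y.
Proof.
case/sc_proj_fiber=> h ->; apply/setP => g; rewrite !inE actC.
by rewrite (inj_eq (inv_inj (actK h))).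
Qed.

Lemma isotropy_add x g h :
  g \in isotropy x -> h \in isotropy x -> g + h \in isotropy x.
Proof. by rewrite !inE sc_actD => /eqP gx /eqP ->; apply/eqP. Qed.

(** In an equivariant chart the isotropy group of a point is a coordinate
    subgroup: a sign change fixes a vector exactly when it only affects
    coordinates that vanish. *)
Lemma isotropy_chart x : exists (c : chart R n M)
    (theta : {additive 'rV['F_2]_n -> 'rV['F_2]_n}),
  [/\ bijective theta, chart_dom c x,
      forall g y, chart_dom c y -> chart_dom c (act g y) /\
        chart_fun c (act g y) = sign_action (theta g) (chart_fun c y),
      forall y, chart_dom c y ->
        cube_depth (proj y) = orthant_depth (chart_fun c y) &
      forall g y, chart_dom c y -> (g \in isotropy y) =
        (row_support (theta g) \subset [set i | chart_fun c y 0 i == 0])%SET].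
Proof.
have [c [c_smooth c_equiv cx]] := @sc_locally_standard R n M x.
have [theta thetaB c_act] := c_equiv.
exists c, theta; split=> // [y cy|g y cy]; first exact: sc_proj_corners.
have [cgy funE] := c_act g y cy.
have -> : (g \in isotropy y) =
    (sign_action (theta g) (chart_fun c y) == chart_fun c y).
  rewrite inE -funE; apply/eqP/eqP => [->//|E].
  by rewrite -(chart_funK (mem_set cgy)) E chart_funK ?inE.
apply/eqP/fintype.subsetP => [E i|S].
  rewrite !inE => gi0; have := congr1 (fun w : 'rV_n => w 0 i) E.
  rewrite mxE (negPf gi0) => /eqP; rewrite eq_sym -subr_eq0 opprK.
  by rewrite -mulr2n mulrn_eq0.
apply/rowP => i; rewrite mxE; case: eqVneq => // gi0.
by have := S i; rewrite !inE gi0 => /(_ isT)/eqP ->; rewrite oppr0.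
Qed.

(** The codimension of the face through the image of a point is the number of
    vanishing coordinates in a chart, so it determines the size of the isotropy
    group. *)
Lemma card_isotropy x : #|isotropy x| = (2 ^ cube_depth (proj x))%N.
Proof.
have [c [theta [thetaB cx _ depthE stabE]]] := isotropy_chart x.
rewrite depthE // -card_rows_supported_on.
rewrite -(card_imset _ (bij_inj thetaB)); apply: eq_card => h.
have [thetaV thetaK thetaVK] := thetaB.
rewrite [RHS]inE; apply/imsetP/idP => [[g + ->]|hZ]; first by rewrite stabE.
by exists (thetaV h); rewrite ?thetaVK // stabE // thetaVK.
Qed.

(** A coset of the isotropy group when the two points lie in the same orbit. *)
Definition transporter x y : {set 'rV['F_2]_n} := [set g | act g x == y]%SET.

Lemma card_transporter x y : proj x = proj y ->
  #|transporter x y| = (2 ^ cube_depth (proj x))%N.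
Proof.
case/sc_proj_fiber=> h ->; rewrite -card_isotropy.
rewrite -[RHS](card_imset _ (addrI h)); apply: eq_card => g.
apply/idP/imsetP => [|[k + ->]]; rewrite !inE; last first.
  by rewrite sc_actD => /eqP->.
move=> /eqP E; exists (h + g); last by rewrite addrA F2row_addrr add0r.
by rewrite inE sc_actD E actK.
Qed.

End Isotropy.

(** * Continuous sections of the orbit map *)

Lemma cvg_row (T : Type) (U : topologicalType) n (F : set_system T)
    (f : T -> 'rV[U]_n) (v : 'rV[U]_n) : Filter F ->
  (forall i, (fun t => f t 0 i) @ F --> v 0 i) -> f @ F --> v.
Proof.
move=> FF fv A [P Pv sPA].
have : \forall t \near F, forall i, P 0 i (f t 0 i).
  by apply: filter_forall => i; exact: (fv i _ (Pv 0 i)).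
by apply: filterS => t Pt; apply: sPA => i j; rewrite ord1.
Qed.

Definition row_norms (R : realType) n (v : 'rV[R]_n) : 'rV[R]_n :=
  \row_i `|v 0 i|.

Lemma row_norms_continuous (R : realType) n : continuous (@row_norms R n).
Proof.
move=> v; apply: (@cvg_row _ _ _ (nbhs v)) => i; rewrite mxE.
under eq_fun do rewrite mxE.
by apply: cvg_norm; exact: coord_continuous.
Qed.

Lemma row_norms_sign (R : realType) n h (v : 'rV[R]_n) :
  row_norms (sign_action h v) = row_norms v.
Proof. by apply/rowP => i; rewrite !mxE; case: ifP; rewrite ?normrN. Qed.

Lemma row_norms_is_sign (R : realType) n (v : 'rV[R]_n) :
  exists h, row_norms v = sign_action h v.
Proof.
exists (indicator_row [set i | v 0 i < 0]%SET); apply/rowP => i.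
rewrite !mxE inE; case: ltrP => vi; rewrite /= ?oner_eq0 ?eqxx.
  exact: ltr0_norm.
exact: ger0_norm.
Qed.

Section Sections.
Variables (R : realType) (n : nat) (M : small_cover R n).
Implicit Types (x y : M) (g h : 'rV['F_2]_n) (v w : 'rV[R]_n).
Local Notation act := (@sc_act R n M).
Local Notation proj := (@sc_proj R n M).

Definition section_on (A : set 'rV[R]_n) (s : 'rV[R]_n -> M) : Prop :=
  forall v, A v -> proj (s v) = v /\ s @ within A (nbhs v) --> s v.

Lemma section_on_proj A s v : section_on A s -> A v -> proj (s v) = v.
Proof. by move=> sA /sA[]. Qed.

Lemma section_onS A B s : A `<=` B -> section_on B s -> section_on A s.
Proof.
move=> AB sB v /AB/sB[-> cs]; split=> //; apply: (cvg_trans _ cs).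
by move=> P; apply: (@filterS _ (nbhs v)) => w h /AB; exact: h.
Qed.

Lemma section_on_act A s g : section_on A s -> section_on A (act g \o s).
Proof.
move=> sA v /sA[E cs]; split; first by rewrite /= proj_act.
apply: cvg_comp cs _; exact: act_continuous.
Qed.

Lemma proj_preimage : exists pre : 'rV[R]_n -> M,
  forall v, cube R n v -> proj (pre v) = v.
Proof.
have [x0 _] : exists x : M, proj x = 0.
  by apply: proj_surj => i; rewrite mxE lexx ler01.
exists (fun v => if pselect (cube R n v) is left h
  then sval (cid (proj_surj M h)) else x0).
by move=> v hv; case: pselect => // h; case: cid.
Qed.

(** Nearby orbits meet every neighborhood of a point: the orbit map is open. *)
Lemma near_proj (x : M) (W : set M) : nbhs x W ->
  \forall v \near proj x, cube R n v -> exists2 y, W y & proj y = v.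
Proof.
rewrite nbhsE; case=> O [oO Ox] OW; have [V oV imE] := proj_open oO.
have [Vx _] : (V `&` cube R n) (proj x) by rewrite -imE; exists x.
apply: filterS (open_nbhs_nbhs (conj oV Vx)) => v Vv cv.
have : (V `&` cube R n) v by [].
by rewrite -imE => -[y /OW Wy <-]; exists y.
Qed.

(** A chart identifies the orbits of its domain with the vectors of its
    codomain that have nonnegative coordinates.  Sending an orbit to its
    representative in the orthant is a section, and it is continuous because
    the orbit map is open. *)
Lemma local_section v0 : cube R n v0 -> exists s,
  exists2 V, nbhs v0 V & section_on (V `&` cube R n) s.
Proof.
move=> cv0; have [pre preK] := proj_preimage.
have [c [theta [thetaB cx act_chart _ _]]] := isotropy_chart (pre v0).
have [thetaV _ thetaVK] := thetaB.
pose fold x := chart_inv c (row_norms (chart_fun c x)).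
have fold_orbit x : chart_dom c x ->
    chart_cod c (row_norms (chart_fun c x)) /\ exists g, fold x = act g x.
  move=> cx'; have [h hE] := row_norms_is_sign (chart_fun c x).
  have [cg] := act_chart (thetaV h) x cx'; rewrite thetaVK -hE => funE.
  rewrite -funE; split; first exact: chart_funS.
  by exists (thetaV h); rewrite /fold -funE chart_funK ?inE.
have fold_act g x : chart_dom c x -> fold (act g x) = fold x.
  move=> cx'; have [_ E] := act_chart g x cx'.
  by rewrite /fold E row_norms_sign.
have fold_continuous x : chart_dom c x -> fold @ x --> fold x.
  move=> cx'; have [cn _] := fold_orbit x cx'.
  apply: (@cvg_comp _ _ _ (fun x => row_norms (chart_fun c x)) (chart_inv c)).
    apply: continuous_comp; first by apply: chart_fun_continuous; rewrite inE.
    exact: row_norms_continuous.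
  by apply: chart_inv_continuous; rewrite inE.
have dom_nbhs x : chart_dom c x -> nbhs x (chart_dom c).
  by move=> cx'; apply: open_nbhs_nbhs; split=> //; apply: chart_dom_open.
have sE x : chart_dom c x -> fold (pre (proj x)) = fold x.
  move=> cx'; have /esym/sc_proj_fiber[g ->] := preK _ (proj_cube x).
  exact: fold_act.
exists (fold \o pre), [set v | cube R n v -> exists2 x, chart_dom c x & proj x = v].
  by rewrite -[v0]preK //; apply: near_proj; apply: dom_nbhs.
move=> v [vV cv]; have [x cx' vE] := vV cv; split=> /=.
  have [_ [g]] := fold_orbit x cx'.
  by rewrite -vE sE // => ->; rewrite proj_act.
move=> W; rewrite -{1}vE sE // => sW.
have Wx : nbhs x (fold @^-1` W) by apply: fold_continuous.
have : \forall w \near v, cube R n w ->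
    exists2 y, (fold @^-1` W `&` chart_dom c) y & proj y = w.
  by rewrite -vE; apply: near_proj; apply: filterI => //; apply: dom_nbhs.
apply: (@filterS _ (nbhs v)) => w h [_ /h[y [Wy cy] <-]].
by rewrite /= sE.
Qed.

End Sections.

Lemma hausdorff_cvg_neq (T : Type) (X : topologicalType) (F : set_system T)
    (f1 f2 : T -> X) (x1 x2 : X) : Filter F -> hausdorff_space X ->
  f1 @ F --> x1 -> f2 @ F --> x2 -> x1 != x2 ->
  \forall t \near F, f1 t <> f2 t.
Proof.
rewrite open_hausdorff => FF haus cvg1 cvg2 /haus.
move=> [[V W] [/= /set_mem Vx1 /set_mem Wx2] [oV oW /eqP VW0]].
have near1 : \forall t \near F, V (f1 t).
  exact: (cvg1 _ (open_nbhs_nbhs (conj oV Vx1))).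
have near2 : \forall t \near F, W (f2 t).
  exact: (cvg2 _ (open_nbhs_nbhs (conj oW Wx2))).
apply: filterS2 near1 near2 => t Vt Wt E.
have : (V `&` W) (f1 t) by split; rewrite // E.
by rewrite VW0.
Qed.

Section Transport.
Variables (R : realType) (n : nat) (M : small_cover R n).
Implicit Types (x y : M) (g h : 'rV['F_2]_n) (v w : 'rV[R]_n).
Local Notation act := (@sc_act R n M).
Local Notation proj := (@sc_proj R n M).


(** As the space is Hausdorff and the group is finite, no new group element can
    carry one section to the other in the limit. *)
Lemma transporter_near A (s1 s2 : 'rV[R]_n -> M) v :
  section_on A s1 -> section_on A s2 -> A v ->
  \forall w \near v, A w ->
    transporter (s1 w) (s2 w) \subset transporter (s1 v) (s2 v).
Proof.
move=> s1A s2A Av.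
have : \forall w \near v, forall g, g \notin transporter (s1 v) (s2 v) ->
    A w -> g \notin transporter (s1 w) (s2 w).
  apply: (@filter_forall _ 'rV['F_2]_n _ (nbhs v)) => g.
  rewrite inE; have [|neq] := eqVneq (act g (s1 v)) (s2 v).
    by move=> _; apply: (@filterE _ (nbhs v)).
  have [[_ c1] [_ c2]] := (section_on_act g s1A Av, s2A v Av).
  have near_neq : \forall w \near v, A w -> act g (s1 w) <> s2 w.
    exact: hausdorff_cvg_neq (@sc_hausdorff R n M) c1 c2 neq.
  by apply: filterS near_neq => w h _ Aw; rewrite inE; apply/eqP; exact: h.
apply: filterS => w h Aw; apply/fintype.subsetP => g.
by apply: contraLR => /h; apply.
Qed.

(** Along a segment whose points lie in open faces of a fixed dimension, with
    the possible exception of its endpoint, the set of group elements carrying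
    one section to the other has constant size, so by semicontinuity it is
    locally constant. *)
Lemma section_transport A (s1 s2 : 'rV[R]_n -> M) v0 v1 d g :
  section_on A s1 -> section_on A s2 ->
  (forall t : R, 0 <= t <= 1 -> A (v0 + t *: (v1 - v0))) ->
  (forall t : R, 0 <= t < 1 -> cube_depth (v0 + t *: (v1 - v0)) = d) ->
  act g (s1 v0) = s2 v0 -> act g (s1 v1) = s2 v1.
Proof.
move=> s1A s2A gA gd E0; pose gam t : 'rV[R]_n := v0 + t *: (v1 - v0).
pose tr t := transporter (s1 (gam t)) (s2 (gam t)).
have gam_cont (t : R) : gam @ t --> gam t.
  by apply: cvgD; [exact: cvg_cst|apply: cvgZr_tmp; exact: cvg_id].
have tr_near (t : R) : 0 <= t <= 1 ->
    \forall u \near t, 0 <= u <= 1 -> tr u \subset tr t.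
  move=> t01; have near_t : \forall u \near t, A (gam u) -> tr u \subset tr t.
    exact: (gam_cont t _ (transporter_near s1A s2A (gA t t01))).
  by apply: filterS near_t => u h /gA/h.
have card_tr (t : R) : 0 <= t < 1 -> #|tr t| = (2 ^ d)%N.
  move=> /[dup] /andP[t0 t1] /gd <-.
  have At : A (gam t) by apply: gA; rewrite t0 ltW.
  by rewrite card_transporter (section_on_proj s1A) ?(section_on_proj s2A).
pose T : set R := [set t | 0 <= t <= 1 /\ g \in tr t].
(* The supremum of T is shown to belong to T, and then to be 1. *)
have T0 : T 0.
  by split; rewrite ?lexx ?ler01 // inE /gam scale0r addr0 E0.
have supT : has_sup T.
  by split; [exists 0|exists 1 => t [/andP[]]].
have tau01 : 0 <= sup T <= 1.
  apply/andP; split; first exact: (sup_upper_bound supT).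
  by apply: ge_sup => [|t [/andP[]]]; [exists 0|].
have Tsup : g \in tr (sup T).
  apply/negPn/negP => gN.
  have /nbhs_ballP[e /= e0 he] := tr_near _ tau01.
  have [t [t01 gt] lt_t] := sup_adherent e0 supT.
  have le_t : t <= sup T by apply: (sup_upper_bound supT).
  have : tr t \subset tr (sup T).
    apply: he => //; rewrite /ball /= ger0_norm ?subr_ge0 //.
    by rewrite ltrBlDr -ltrBlDl.
  by move/fintype.subsetP/(_ _ gt); rewrite (negPf gN).
have [sup1|] := eqVneq (sup T) 1.
  by move: Tsup; rewrite sup1 inE /gam scale1r addrC subrK => /eqP.
move=> sup_neq1; have sup_lt1 : sup T < 1.
  by rewrite lt_neqAle sup_neq1; case/andP: tau01.
have /nbhs_ballP[e /= e0 he] : \forall u \near sup T,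
    u < 1 /\ (0 <= u <= 1 -> tr u \subset tr (sup T)).
  by apply: filterI; [exact: lt_nbhsl|exact: tr_near].
pose u := sup T + e / 2.
have [u1 sub_tr] : u < 1 /\ (0 <= u <= 1 -> tr u \subset tr (sup T)).
  apply: he; rewrite /ball /= /u opprD addrA subrr sub0r normrN.
  by rewrite gtr0_norm ?divr_gt0 // ltr_pdivrMr // ltr_pMr // ltr1n.
have u0 : 0 <= u by rewrite addr_ge0 ?divr_ge0 ?(ltW e0) //; case/andP: tau01.
have u01 : 0 <= u <= 1 by rewrite u0 ltW.
have eq_tr : tr u = tr (sup T).
  have sup01 : 0 <= sup T < 1 by rewrite sup_lt1 andbT; case/andP: tau01.
  by apply/eqP; rewrite eqEcard sub_tr // !card_tr //; apply/andP.
have /(sup_upper_bound supT) : T u by split; rewrite ?eq_tr.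
by rewrite gerDl leNgt divr_gt0.
Qed.

End Transport.

Definition box (R : realType) n (a b : 'rV[R]_n) : set 'rV[R]_n :=
  [set v | forall i, a 0 i <= v 0 i <= b 0 i].

Definition fat_box (R : realType) n (a b : 'rV[R]_n) : Prop :=
  forall i, [/\ 0 <= a 0 i, a 0 i < b 0 i & b 0 i <= 1].

Definition set_coord (R : realType) n (v : 'rV[R]_n) i (c : R) : 'rV[R]_n :=
  \row_j (if j == i then c else v 0 j).

Lemma box_cube (R : realType) n (a b : 'rV[R]_n) :
  fat_box a b -> box a b `<=` cube R n.
Proof.
move=> ab v vab i; have [a0 _ b1] := ab i; have /andP[av vb] := vab i.
by rewrite (le_trans a0 av) (le_trans vb b1).
Qed.

Lemma cube_depth_interior (R : realType) n (v : 'rV[R]_n) :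
  (forall i, 0 < v 0 i < 1) -> cube_depth v = 0%N.
Proof.
move=> v01; apply/eqP; rewrite cards_eq0; apply/eqP/setP => i; rewrite !inE.
by have /andP[v0 v1] := v01 i; rewrite gt_eqF // lt_eqF.
Qed.

Section GlobalSection.
Variables (R : realType) (n : nat) (M : small_cover R n).
Implicit Types (x y : M) (g h : 'rV['F_2]_n) (v w a b : 'rV[R]_n).
Local Notation act := (@sc_act R n M).
Local Notation proj := (@sc_proj R n M).

(** Two sections over boxes that share a wall differ on the interior of the wall
    by a constant group element, because the action is free there; translating
    one of them by this element makes the two match. *)
Lemma section_merge a b i (c : R) : fat_box a b -> a 0 i < c < b 0 i ->
  (exists s : 'rV[R]_n -> M, section_on (box a (set_coord b i c)) s) ->
  (exists s : 'rV[R]_n -> M, section_on (box (set_coord a i c) b) s) ->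
  exists s : 'rV[R]_n -> M, section_on (box a b) s.
Proof.
move=> ab /andP[ac cb] [s1 s1B] [s2 s2B].
have lower v : box a b v -> v 0 i <= c -> box a (set_coord b i c) v.
  move=> vab vc j; rewrite mxE; case: eqVneq => [->|_]; last exact: vab.
  by rewrite vc andbT; case/andP: (vab i).
have upper v : box a b v -> c <= v 0 i -> box (set_coord a i c) b v.
  move=> vab vc j; rewrite mxE; case: eqVneq => [->|_]; last exact: vab.
  by rewrite vc; case/andP: (vab i).
pose D : set 'rV[R]_n := [set v | box a b v /\ v 0 i = c].
have s1D : section_on D s1.
  by apply: section_onS s1B => v [vab vc]; apply: lower => //; rewrite vc.
have s2D : section_on D s2.
  by apply: section_onS s2B => v [vab vc]; apply: upper => //; rewrite vc.
(* The segment from the center of the wall to a point of the wall stays in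
   the interior of the cube, except possibly at its endpoint. *)
pose z : 'rV[R]_n := \row_j if j == i then c else (a 0 j + b 0 j) / 2.
have zi : z 0 i = c by rewrite mxE eqxx.
have zab j : a 0 j < z 0 j < b 0 j.
  rewrite mxE; case: eqVneq => [->|_]; first by rewrite ac.
  by have [_ /midf_lt[-> ->]] := ab j.
have Dz : D z by split=> // j; have /andP[/ltW-> /ltW->] := zab j.
have [g gz] : exists g, s2 z = act g (s1 z).
  by apply/sc_proj_fiber; rewrite (section_on_proj s1D) ?(section_on_proj s2D).
have gE v : D v -> act g (s1 v) = s2 v.
  move=> [vab vc].
  pose seg (t : R) := z + t *: (v - z).
  have segE (t : R) j : seg t 0 j = (1 - t) * z 0 j + t * v 0 j.
    by rewrite !mxE; ring.
  have seg_ab (t : R) j : 0 <= t < 1 -> a 0 j < seg t 0 j < b 0 j.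
    move=> /andP[t0 t1]; rewrite segE.
    have /andP[] := zab j; have /andP[] := vab j; nra.
  have segD (t : R) : 0 <= t <= 1 -> D (seg t).
    move=> /andP[t0 t1]; split=> [j|]; last by rewrite segE zi vc; ring.
    by rewrite segE; have /andP[] := zab j; have /andP[] := vab j; nra.
  apply: (section_transport (v0 := z) (d := 0%N) s1D s2D) => // t t01.
  apply: cube_depth_interior => j; have [a0 _ b1] := ab j.
  have /andP[at_ tb] := seg_ab t j t01.
  by rewrite (le_lt_trans a0 at_) (lt_le_trans tb b1).
pose s v := if v 0 i <= c then act g (s1 v) else s2 v.
exists s => v vab; split.
  rewrite /s; case: ifPn => [vc|]; first rewrite proj_act.
    by apply: (section_on_proj s1B); apply: lower.
  rewrite -ltNge => /ltW vc.
  by apply: (section_on_proj s2B); apply: upper.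
move=> W sW.
have near1 : v 0 i <= c ->
    \forall w \near v, box a b w -> w 0 i <= c -> W (act g (s1 w)).
  move=> vc; have [_ c1] := section_on_act g s1B (lower v vab vc).
  move: sW; rewrite /s vc => /c1.
  by apply: (@filterS _ (nbhs v)) => w h wab wc; apply: h; apply: lower.
have near2 : c <= v 0 i ->
    \forall w \near v, box a b w -> c <= w 0 i -> W (s2 w).
  move=> vc; have [_ c2] := s2B v (upper v vab vc).
  have : nbhs (s2 v) W.
    move: sW; rewrite /s; case: ifP => // vc'; rewrite gE //; split=> //.
    by apply/eqP; rewrite eq_le vc vc'.
  move=> /c2.
  by apply: (@filterS _ (nbhs v)) => w h wab wc; apply: h; apply: upper.
have coordE := @coord_continuous R 1 n 0 i v.
rewrite /s; have [vc|vc|vc] := ltgtP (v 0 i) c.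
- have := coordE _ (lt_nbhsl vc).
  apply: (@filterS2 _ (nbhs v)) (near1 (ltW vc)) => w h wc wab.
  by rewrite /= (ltW wc); apply: h => //; apply: ltW.
- have := coordE _ (lt_nbhsr vc).
  apply: (@filterS2 _ (nbhs v)) (near2 (ltW vc)) => w h wc wab.
  by rewrite /= leNgt wc; apply: h => //; apply: ltW.
- have [h1 h2] : v 0 i <= c /\ c <= v 0 i by rewrite vc.
  apply: (@filterS2 _ (nbhs v)) (near1 h1) (near2 h2) => w k1 k2 wab.
  by rewrite /=; case: ifPn => [/(k1 wab)//|]; rewrite -ltNge => /ltW/(k2 wab).
Qed.

(** The Lebesgue number of the cover of the cube by domains of local sections. *)
Lemma section_small_boxes : exists2 e : R, 0 < e & forall a b,
  fat_box a b -> (forall i, b 0 i - a 0 i < e) ->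
  exists s : 'rV[R]_n -> M, section_on (box a b) s.
Proof.
have cube_compact : compact (cube R n).
  have := @rV_compact R n (fun=> `[0, 1]%classic) (fun=> @segment_compact R 0 1).
  by congr (compact _); apply/seteqP; split=> v /= h i; have := h i; rewrite in_itv.
move/compact_near_coveringP : cube_compact.
pose P (e : R) v := exists s : 'rV[R]_n -> M, section_on (ball v e `&` cube R n) s.
move=> /(_ R (0^'+) P _)[].
  move=> v cv; have [s [V /nbhs_ballP[r /= r0 rV] sV]] := local_section M cv.
  have r2 : 0 < r / 2 by rewrite divr_gt0.
  exists (ball v (r / 2), [set e | e < r / 2]) => /=.
    split; first exact: nbhsx_ballx.
    exact: nbhs_right_lt.
  move=> [w e] /= [vw er]; exists s; apply: section_onS sV => u [wu cu].
  split=> //; apply: rV; rewrite [r]splitr; apply: ball_triangle vw _.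
  exact: le_ball (ltW er) _ wu.
move=> d /= d0 hd; exists (d / 2); first by rewrite divr_gt0.
move=> a b ab small.
have d2 : 0 < d / 2 by rewrite divr_gt0.
have [||s sP] := hd (d / 2) _ d2 a.
- rewrite /ball /= sub0r normrN gtr0_norm //.
  by rewrite ltr_pdivrMr // ltr_pMr // ltr1n.
- by apply: (box_cube ab) => i; have [_ /ltW aa _] := ab i; rewrite lexx.
exists s; apply: section_onS sP => v vab; split; last exact: box_cube ab _ vab.
split=> // k i; rewrite ord1 /ball /= distrC ger0_norm; last first.
  by rewrite subr_ge0; case/andP: (vab i).
apply: le_lt_trans (small i); rewrite lerB //.
by case/andP: (vab i).
Qed.

(** A box with a side of length at least e is halved along it; both halves have
    a total side length smaller by at least e / 2, which bounds the depth of the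
    bisection. *)
Lemma section_box (e : R) (m : nat) a b :
  0 < e ->
  (forall a b, fat_box a b -> (forall i, b 0 i - a 0 i < e) ->
    exists s : 'rV[R]_n -> M, section_on (box a b) s) ->
  fat_box a b -> \sum_i (b 0 i - a 0 i) <= m%:R * (e / 2) ->
  exists s : 'rV[R]_n -> M, section_on (box a b) s.
Proof.
move=> e0 small; elim: m a b => [|m IHm] a b ab sum_ab.
  apply: small => // i; apply: le_lt_trans e0; rewrite mul0r in sum_ab.
  apply: le_trans sum_ab; rewrite (bigD1 i) //= lerDl sumr_ge0 // => j _.
  by rewrite subr_ge0 ltW //; case: (ab j).
have [/forallP/= ?|/forallPn[/= i]] := boolP [forall i, b 0 i - a 0 i < e].
  exact: small.
rewrite -leNgt => le_e; pose c := (a 0 i + b 0 i) / 2.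
have [a0 lt_ab b1] := ab i; have [ac cb] := midf_lt lt_ab.
have split_sum (u w : 'rV[R]_n) : (forall j, j != i -> u 0 j = a 0 j) ->
    (forall j, j != i -> w 0 j = b 0 j) -> w 0 i - u 0 i = (b 0 i - a 0 i) / 2 ->
    \sum_j (w 0 j - u 0 j) <= m%:R * (e / 2).
  move=> ua wb wui; move: sum_ab; rewrite (bigD1 i) //= [X in _ -> X <= _](bigD1 i) //=.
  have -> : \sum_(j | j != i) (w 0 j - u 0 j) = \sum_(j | j != i) (b 0 j - a 0 j).
    by apply: eq_bigr => j ji; rewrite ua ?wb.
  by rewrite wui -natr1; lra.
apply: (@section_merge a b i c) => //; first by rewrite ac.
- apply: IHm => [j|].
    rewrite mxE; case: eqVneq => [->|_]; last exact: ab.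
    by split=> //; apply: le_trans (ltW cb) b1.
  apply: split_sum => [//|j /negPf ji|]; rewrite mxE ?ji ?eqxx //.
  by rewrite /c; lra.
- apply: IHm => [j|].
    rewrite mxE; case: eqVneq => [->|_]; last exact: ab.
    by split=> //; apply: le_trans a0 (ltW ac).
  apply: split_sum => [j /negPf ji|//|]; rewrite mxE ?ji ?eqxx //.
  by rewrite /c; lra.
Qed.

Lemma global_section : exists s : 'rV[R]_n -> M, section_on (cube R n) s.
Proof.
have [e e0 small] := section_small_boxes.
have cubeE : cube R n = box 0 (const_mx 1).
  by apply/seteqP; split=> v h i; have := h i; rewrite !mxE.
rewrite cubeE.
pose S := \sum_i ((const_mx 1 : 'rV[R]_n) 0 i - (0 : 'rV[R]_n) 0 i).
apply: (@section_box e (Num.bound (S / (e / 2)))) => //.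
  by move=> i; rewrite !mxE lexx ltr01.
rewrite -ler_pdivrMr ?divr_gt0 //.
apply/ltW; apply: archi_boundP; rewrite divr_ge0 ?divr_ge0 ?(ltW e0) //.
by apply: sumr_ge0 => i _; rewrite !mxE subr0.
Qed.

End GlobalSection.

(** * The characteristic function *)

Definition on_facet (R : realType) n (v : 'rV[R]_n) (F : 'I_n * bool) : bool :=
  v 0 F.1 == F.2%:R.

Lemma cube_depth_facet (R : realType) n (v : 'rV[R]_n) F :
  on_facet v F -> (forall i, i != F.1 -> 0 < v 0 i < 1) -> cube_depth v = 1%N.
Proof.
move=> /eqP vF v01; apply/eqP/cards1P; exists F.1; apply/setP => i.
rewrite !inE; have [->|/v01/andP[v0 v1]] := eqVneq i F.1.
  by rewrite vF; case: F.2; rewrite eqxx ?orbT.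
by rewrite gt_eqF // lt_eqF.
Qed.

Section CharacteristicFunction.
Variables (R : realType) (n : nat) (M : small_cover R n).
Variable s : 'rV[R]_n -> M.
Hypothesis s_section : section_on (cube R n) s.
Implicit Types (x y : M) (g h : 'rV['F_2]_n) (v w : 'rV[R]_n).
Local Notation act := (@sc_act R n M).
Local Notation proj := (@sc_proj R n M).

(** Uniqueness is only required at points of the open facet, where the isotropy
    group has order two; on smaller faces it is larger. *)
Definition is_facet_generator (F : 'I_n * bool) (l : 'rV['F_2]_n) : Prop :=
  forall v, cube R n v -> on_facet v F ->
    l \in isotropy (s v) /\
    (cube_depth v = 1%N -> forall g, g \in isotropy (s v) -> g != 0 -> g = l).

(** The segment from the center of a facet to any of its points runs in the open
    facet until its endpoint, so the generator of the isotropy group at the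
    center can be transported along it. *)
Lemma facet_generator F : exists l, is_facet_generator F l.
Proof.
pose m : 'rV[R]_n := \row_j (if j == F.1 then F.2%:R else 2^-1).
have mF : m 0 F.1 = F.2%:R by rewrite mxE eqxx.
have m01 j : j != F.1 -> 0 < m 0 j < 1.
  move=> /negPf ji; rewrite mxE ji invr_gt0 ltr0n /=.
  by rewrite invf_lt1 // ltr1n.
have cube_m : cube R n m.
  move=> j; have [->|/m01/andP[/ltW-> /ltW->//]] := eqVneq j F.1.
  by rewrite mF; case: F.2; rewrite !lexx ler01.
have /eqP/cards2P[g [h [neq_gh isoE]]] : #|isotropy (s m)| = 2%N.
  rewrite card_isotropy (section_on_proj s_section cube_m).
  by rewrite (@cube_depth_facet _ _ _ F) //; apply/eqP.
have [l l_iso l0] : exists2 l, l \in isotropy (s m) & l != 0.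
  rewrite isoE; have [g0|] := eqVneq g 0; last by exists g; rewrite ?set21.
  by exists h; rewrite ?set22 // -g0 eq_sym.
exists l => v cv vF; have l_v : l \in isotropy (s v).
  rewrite inE; apply/eqP.
  pose seg (t : R) := m + t *: (v - m).
  have segE (t : R) j : seg t 0 j = (1 - t) * m 0 j + t * v 0 j.
    by rewrite !mxE; ring.
  apply: (section_transport (v0 := m) (d := 1%N) s_section s_section).
  - move=> t /andP[t0 t1] j; rewrite -/(seg t) segE.
    by have /andP[] := cube_m j; have /andP[] := cv j; nra.
  - move=> t /andP[t0 t1]; rewrite -/(seg t); apply: (cube_depth_facet (F := F)).
      by rewrite /on_facet segE mF (eqP vF); apply/eqP; ring.
    move=> j ji; rewrite segE.
    by have /andP[] := m01 j ji; have /andP[] := cv j; nra.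
  - by move: l_iso; rewrite inE => /eqP.
split=> // depth1 g' g'_iso g'0.
have : [set 0; l]%SET = isotropy (s v).
  apply/eqP; rewrite eqEcard cards2 eq_sym l0 card_isotropy.
  rewrite (section_on_proj s_section cv) depth1 andbT.
  apply/fintype.subsetP => k; rewrite !inE => /orP[/eqP->|/eqP->].
    by rewrite sc_act0.
  by move: l_v; rewrite inE.
move/setP/(_ g'); rewrite g'_iso !inE (negPf g'0) /=.
by move/eqP.
Qed.

Variable lam : 'I_n * bool -> 'rV['F_2]_n.
Hypothesis lam_gen : forall F, is_facet_generator F (lam F).

(** The isotropy group at a point is generated by the values on the facets
    through that point.  In a chart it is a coordinate subgroup, and each of its
    coordinate vectors generates the isotropy group of nearby points at which
    a single coordinate vanishes: these lie in open facets of the cube. *)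
Lemma isotropy_ind v (P : 'rV['F_2]_n -> Prop) :
  cube R n v -> P 0 -> (forall g h, P g -> P h -> P (g + h)) ->
  (forall F, on_facet v F -> P (lam F)) ->
  forall g, g \in isotropy (s v) -> P g.
Proof.
move=> cv P0 PD Plam.
have [c [theta [thetaB cx _ depthE isoE]]] := isotropy_chart (s v).
set w := chart_fun c (s v) in isoE.
have vE := section_on_proj s_section cv.
have [thetaV thetaK thetaVK] := thetaB.
have facet_of j : exists F, w 0 j = 0 ->
    on_facet v F /\ theta (lam F) = indicator_row [set j]%SET.
  have [wj0|wj] := eqVneq (w 0 j) 0; last first.
    by exists (j, true) => /eqP; rewrite (negPf wj).
  have cw : chart_cod c w by apply: chart_funS.
  have proj_w : proj (chart_inv c w) = v by rewrite chart_funK ?inE.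
  have near_v : \forall v' \near v, forall i,
      (0 < v 0 i -> 0 < (v' : 'rV[R]_n) 0 i) /\
      (v 0 i < 1 -> (v' : 'rV[R]_n) 0 i < 1).
    apply: (@filter_forall _ 'I_n _ (nbhs v)) => i; apply: filterI.
      have [v0|] := boolP (0 < v 0 i); last by move=> _; apply: (@filterE _ (nbhs v)).
      have near_i : \forall v' \near v, 0 < (v' : 'rV[R]_n) 0 i.
        exact: (@coord_continuous R 1 n 0 i v _ (lt_nbhsr v0)).
      by apply: filterS near_i => v' h _.
    have [v0|] := boolP (v 0 i < 1); last by move=> _; apply: (@filterE _ (nbhs v)).
    have near_i : \forall v' \near v, (v' : 'rV[R]_n) 0 i < 1.
        exact: (@coord_continuous R 1 n 0 i v _ (lt_nbhsl v0)).
    by apply: filterS near_i => v' h _.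
  have /nbhs_ballP[e /= e0 he] : \forall u \near w, chart_cod c u /\ forall i,
      (0 < v 0 i -> 0 < proj (chart_inv c u) 0 i) /\
      (v 0 i < 1 -> proj (chart_inv c u) 0 i < 1).
    apply: filterI.
      by apply: open_nbhs_nbhs; split=> //; apply: chart_cod_open.
    have cont : (proj \o chart_inv c) @ w --> v.
      rewrite -proj_w; apply: continuous_comp; last exact: proj_continuous.
      by apply: chart_inv_continuous; rewrite inE.
    exact: cont near_v.
  (* Push w off all the coordinate hyperplanes that contain it but the j-th. *)
  pose u : 'rV[R]_n := \row_k
    (if (w 0 k == 0) && (k != j) then e / 2 else w 0 k).
  have e2 : 0 < e / 2 by rewrite divr_gt0.
  have [cu uv] : chart_cod c u /\ forall i,
      (0 < v 0 i -> 0 < proj (chart_inv c u) 0 i) /\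
      (v 0 i < 1 -> proj (chart_inv c u) 0 i < 1).
    apply: he; split=> // k i; rewrite ord1 mxE; case: ifP => [/andP[/eqP-> _]|_].
      rewrite /ball /= sub0r normrN gtr0_norm //.
      by rewrite ltr_pdivrMr // ltr_pMr // ltr1n.
    exact: ballxx.
  have u_zeros : [set i | u 0 i == 0]%SET = [set j]%SET.
    apply/setP => i; rewrite !inE mxE.
    have [->|ij] := eqVneq i j; first by rewrite andbF wj0 eqxx.
    by rewrite andbT; case: ifPn => [_|/negPf //]; rewrite gt_eqF.
  set y := chart_inv c u in uv *.
  have cy : chart_dom c y by apply: chart_invS.
  have yE : chart_fun c y = u by rewrite chart_invK ?inE.
  have depth1 : cube_depth (proj y) = 1%N.
    by rewrite depthE // yE /orthant_depth u_zeros cards1.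
  have /eqP/cards1P[i iE] := depth1.
  (* The point y lies over an open facet F; it is so close to s v that F
     contains v. *)
  pose F := (i, proj y 0 i == 1); exists F => _.
  have cpy := proj_cube y.
  have yF : on_facet (proj y) F.
    have : i \in [set i]%SET by rewrite set11.
    rewrite -iE inE /on_facet /F /= => /orP[/eqP->|/eqP->]; last by rewrite !eqxx.
    by rewrite [X in nat_of_bool X]eq_sym oner_eq0.
  have [uv0 uv1] := uv i; split.
    have /andP[v0 v1] := cv i; move: yF; rewrite /on_facet /=.
    case: (proj y 0 i == 1) => /eqP pyi.
      by rewrite eq_le v1 leNgt; apply/negP => /uv1; rewrite pyi ltxx.
    by rewrite eq_le v0 andbT leNgt; apply/negP => /uv0; rewrite pyi ltxx.
  rewrite -[RHS]thetaVK; congr (theta _).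
  have [_ uniq_lam] := lam_gen cpy yF.
  apply/esym/uniq_lam => //.
    rewrite (isotropy_proj (y := y)) ?(section_on_proj s_section cpy) //.
    by rewrite isoE // yE u_zeros thetaVK indicator_rowK.
  rewrite -(inj_eq (bij_inj thetaB)) thetaVK raddf0.
  apply/eqP => /rowP/(_ j); rewrite !mxE set11 => /eqP.
  by rewrite oner_eq0.
have [facet facetP] := fin_all_exists facet_of.
move=> g; rewrite isoE // -/w => /fintype.subsetP gw.
have -> : g = \sum_(j in row_support (theta g)) lam (facet j).
  apply: (bij_inj thetaB); rewrite raddf_sum -[LHS]row_supportK.
  rewrite indicator_row_sum; apply: eq_bigr => j /gw; rewrite inE => /eqP wj.
  by have [_ ->] := facetP j wj.
apply: big_ind => // j /gw; rewrite inE => /eqP wj.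
by apply: Plam; have [] := facetP j wj.
Qed.

(** At a vertex of the cube the isotropy group is the whole group, so the values
    on the n facets through the vertex generate it. *)
Lemma vertex_matrix_unit (eps : 'I_n -> bool) :
  (\matrix_(i < n) lam (i, eps i) : 'M['F_2]_n) \in unitmx.
Proof.
set L := (X in X \in _); rewrite -row_full_unit -sub1mx.
apply/row_subP => k; move: (row k 1%:M) => g.
pose v : 'rV[R]_n := \row_i (eps i)%:R.
have cv : cube R n v.
  by move=> i; rewrite mxE; case: (eps i); rewrite !lexx ler01.
apply: (@isotropy_ind v (fun g => (g <= L)%MS) cv).
- exact: sub0mx.
- by move=> ? ?; apply: addmx_sub.
- move=> [i b]; rewrite /on_facet mxE /= => /eqP E.
  have -> : b = eps i.
    move: E; case: b; case: (eps i) => // /eqP; rewrite ?oner_eq0 //.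
    by rewrite eq_sym oner_eq0.
  by rewrite -(rowK (fun i => lam (i, eps i))) row_sub.
have : isotropy (s v) = [set: 'rV['F_2]_n]%SET.
  apply/eqP; rewrite eqEcard finset.subsetT cardsT card_mx card_Fp // mul1n.
  rewrite card_isotropy (section_on_proj s_section cv) leq_pexp2l //.
  rewrite -[X in (X <= _)%N](card_ord n) -cardsT; apply: subset_leq_card.
  by apply/fintype.subsetP => i _; rewrite inE mxE; case: (eps i); rewrite eqxx ?orbT.
by move=> ->; rewrite inE.
Qed.

End CharacteristicFunction.

(** * Reconstruction of a small cover from its isotropy groups *)

Section Reconstruction.
Variables (R : realType) (n : nat) (M N : small_cover R n).
Variables (sM : 'rV[R]_n -> M) (sN : 'rV[R]_n -> N).
Hypotheses (sM_section : section_on (cube R n) sM)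
  (sN_section : section_on (cube R n) sN).
Local Notation actM := (@sc_act R n M).
Local Notation actN := (@sc_act R n N).

Lemma section_proj_continuous (K : small_cover R n) (s : 'rV[R]_n -> K) :
  section_on (cube R n) s -> continuous (s \o @sc_proj R n K).
Proof.
move=> s_section x W sW; have [_ cs] := s_section _ (proj_cube x).
have : nbhs x (@sc_proj R n K @^-1`
    [set v | cube R n v -> (s @^-1` W) v]).
  by apply: proj_continuous; exact: cs.
by apply: filterS => y; apply; apply: proj_cube.
Qed.

Lemma orbit_section x : exists g, actM g (sM (sc_proj x)) = x.
Proof.
have /sc_proj_fiber[g gx] := section_on_proj sM_section (proj_cube x).
by exists g; rewrite [in RHS]gx.
Qed.

(** The map g . sM v |-> theta g . sN (phi v) is well defined because theta
    respects isotropy.  It is continuous because the space M is the union of the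
    finitely many closed sets of points of the form g . sM v with g fixed. *)
Lemma reconstruct_map (phi : 'rV[R]_n -> 'rV[R]_n)
    (theta : 'rV['F_2]_n -> 'rV['F_2]_n) :
  continuous phi -> (forall v, cube R n v -> cube R n (phi v)) ->
  (forall g h, theta (g + h) = theta g + theta h) ->
  (forall v, cube R n v -> forall g, g \in isotropy (sM v) ->
    theta g \in isotropy (sN (phi v))) ->
  exists2 f : M -> N, continuous f & forall g v, cube R n v ->
    f (actM g (sM v)) = actN (theta g) (sN (phi v)).
Proof.
move=> phi_cont phi_cube thetaD theta_iso.
pose piece g (x : M) := actN (theta g) (sN (phi (sc_proj x))).
pose label x := sval (cid (orbit_section x)).
have labelP x : actM (label x) (sM (sc_proj x)) = x by rewrite /label; case: cid.
pose f x := piece (label x) x.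
have fE g x : actM g (sM (sc_proj x)) = x -> f x = piece g x.
  move=> gx; rewrite /f /piece; apply: (inv_inj (actK (theta g))).
  rewrite actK -sc_actD -thetaD; apply/eqP.
  have := theta_iso _ (proj_cube x) (g + label x); rewrite !inE => -> //.
  by rewrite sc_actD labelP -{1}gx actK.
exists f => [x W fW|g v cv]; last first.
  have vE := section_on_proj sM_section cv.
  by rewrite (fE g) /piece proj_act vE.
(* The labels that occur near x already occur at x. *)
have near_label : \forall y \near x, forall g,
    actM g (sM (sc_proj x)) != x -> actM g (sM (sc_proj y)) <> y.
  apply: (@filter_forall _ 'rV['F_2]_n _ (nbhs x)) => g.
  have [|neq] := eqVneq (actM g (sM (sc_proj x))) x.
    by move=> _; apply: (@filterE _ (nbhs x)).
  have cont : actM g \o (sM \o @sc_proj R n M) @ x --> actM g (sM (sc_proj x)).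
    apply: continuous_comp; last exact: act_continuous.
    exact: section_proj_continuous.
  have near_neq : \forall y \near x, actM g (sM (sc_proj y)) <> y.
    exact: hausdorff_cvg_neq (@sc_hausdorff R n M) cont cvg_id neq.
  by apply: filterS near_neq => y h _.
have near_piece : \forall y \near x, forall g,
    actM g (sM (sc_proj x)) == x -> W (piece g y).
  apply: (@filter_forall _ 'rV['F_2]_n _ (nbhs x)) => g.
  have [gx|_] := eqVneq (actM g (sM (sc_proj x))) x; last first.
    exact: (@filterE _ (nbhs x)).
  have phi_proj : cube R n (phi (sc_proj x)) by apply: phi_cube; apply: proj_cube.
  have [_ cN] := section_on_act (theta g) sN_section phi_proj.
  rewrite (fE g x gx) in fW.
  have : \forall y \near x, cube R n (phi (sc_proj y)) -> W (piece g y).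
    have cont : phi \o @sc_proj R n M @ x --> phi (sc_proj x).
      by apply: continuous_comp; [exact: proj_continuous|exact: phi_cont].
    exact: (cont _ (cN _ fW)).
  by apply: filterS => y h _; apply/h/phi_cube/proj_cube.
apply: filterS2 near_label near_piece => y h1 h2.
by apply: h2; apply/negPn/negP => /h1; apply; exact: labelP.
Qed.

End Reconstruction.

(** * Matrices with nonzero principal minors and acyclic digraphs *)

Definition matrix_digraph n (A : 'M['F_2]_n) : digraph n :=
  [set e | (e.1 != e.2) && (A e.1 e.2 != 0)]%SET.

(** The identity matrix with the rows indexed by I replaced by those of A; its
    determinant is the principal minor of A on I. *)
Definition replace_rows n (A : 'M['F_2]_n) (I : {set 'I_n}) : 'M['F_2]_n :=
  \matrix_(i < n) (if i \in I then row i A else delta_mx 0 i).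

Definition principal_unit n (A : 'M['F_2]_n) : Prop :=
  forall I : {set 'I_n}, replace_rows A I \in unitmx.

Section PrincipalUnit.
Variables (n : nat) (A : 'M['F_2]_n).
Hypothesis A_unit : principal_unit A.

(** If the rows indexed by I add up to zero in the columns indexed by I, they
    add up to a combination of the unit vectors outside of I, which is a linear
    relation between the rows of a nonsingular matrix. *)
Lemma principal_sum_neq0 (I : {set 'I_n}) :
  (forall j, j \in I -> \sum_(i in I) A i j = 0) -> I = finset.set0.
Proof.
move=> sumA; apply/eqP/set0Pn => -[i0 i0I].
pose u : 'rV['F_2]_n := \row_j (if j \in I then 1 else \sum_(i in I) A i j).
have u0 : u *m replace_rows A I = 0.
  apply/rowP => j; rewrite !mxE (bigID (mem I)) /=.
  rewrite (eq_bigr (fun i => A i j)) => [|i iI]; last by rewrite !mxE iI mul1r mxE.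
  have [jI|jI] := boolP (j \in I).
    rewrite sumA // add0r big1 // => k kI; rewrite !mxE (negPf kI) mxE eqxx /=.
    by case: eqVneq => [E|_]; rewrite ?mulr0 //; move: kI; rewrite -E jI.
  rewrite [X in _ + X](bigD1 j) //= !mxE (negPf jI) mxE !eqxx mulr1.
  rewrite [X in _ + (_ + X)]big1 => [|k /andP[kI kj]]; last first.
    by rewrite !mxE (negPf kI) mxE eqxx eq_sym (negPf kj) mulr0.
  by rewrite addr0; case: (\sum_(i in I) A i j) => [[|[|m]] lt_m] //; apply: val_inj.
have /rowP/(_ i0) : u = 0.
  by rewrite -[u](mulmxK (A_unit I)) u0 mul0mx.
by rewrite !mxE i0I => /eqP; rewrite oner_eq0.
Qed.

Lemma principal_diag i : A i i = 1.
Proof.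
apply: F2_neq0; apply/negP => /eqP Aii0.
have : [set i]%SET = finset.set0.
  by apply: principal_sum_neq0 => j /set1P->; rewrite big_set1.
by move/setP/(_ i); rewrite !inE eqxx.
Qed.

(** In a shortest directed cycle every vertex has exactly one predecessor on the
    cycle, since any other edge would be a chord that cuts off a shorter cycle.
    With the diagonal entry this makes two nonzero entries in each column of the
    principal submatrix on the cycle, and 1 + 1 = 0. *)
Lemma matrix_digraph_acyclic : acyclic (matrix_digraph A).
Proof.
set e := fun i j => (i, j) \in matrix_digraph A.
have eP i j : e i j = (i != j) && (A i j != 0) by rewrite /e inE.
suff acyc m c : (size c <= m)%N -> ucycle e c -> c = [::].
  by move=> c; apply: acyc (leqnn _).
elim: m c => [|m IHm] c; first by rewrite leqn0 size_eq0 => /eqP.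
move=> size_c cyc.
have predecessor j : j \in c -> exists i0,
    [/\ i0 \in c, e i0 j & forall i, i \in c -> e i j -> i = i0].
  move=> /rot_to[k c' rotE].
  have mem_c i : (i \in c) = (i \in j :: c') by rewrite -rotE mem_rot.
  have size_c' : (size c' < m.+1)%N.
    by move: size_c; rewrite -(size_rot k) rotE.
  move: cyc; rewrite -(rot_ucycle k) rotE => /andP[cyc' uniq_c'].
  (* The cycle is rotated to start at j, so the predecessor of j is its last
     vertex. *)
  exists (last j c'); split; first by rewrite mem_c mem_last.
    by move: cyc'; rewrite /= rcons_path => /andP[].
  move=> i; rewrite mem_c inE => /predU1P[->|i_c'] eij.
    by move: eij; rewrite eP eqxx.
  case/splitPr: i_c' cyc' uniq_c' size_c' mem_c rotE => p1 p2.
  case: p2 => [|k' p2]; first by rewrite last_cat.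
  move=> cyc' uniq_c' size_c' _ _.
  have : j :: rcons p1 i = [::].
    apply: IHm.
      move: size_c'; rewrite /= size_cat size_rcons /= !addnS ltnS.
      by apply: leq_trans; rewrite !ltnS leq_addr.
    apply/andP; split.
      move: cyc'; rewrite /= rcons_cat cat_path /= => /and3P[path1 lasti _].
      by rewrite !rcons_path last_rcons path1 lasti eij.
    move: uniq_c'; rewrite -cat1s catA -[_ ++ _ :: _]cat_rcons cat_uniq.
    by rewrite -cats1 -catA cats1 => /andP[].
  by [].
have sum0 j : j \in [set i in c]%SET -> \sum_(i in [set i in c]%SET) A i j = 0.
  rewrite inE => jc; have [i0 [i0c]] := predecessor j jc.
  rewrite eP => /andP[i0j /F2_neq0 Ai0j] i0_uniq.
  rewrite (bigD1 j) ?inE //= (bigD1 i0) ?inE ?i0c //= principal_diag Ai0j.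
  rewrite big1 ?addr0 => [|i]; first exact: val_inj.
  rewrite inE => /andP[/andP[ic ij] ii0]; apply/eqP/negPn/negP => Aij.
  by move: ii0; rewrite (i0_uniq i) ?eqxx // eP ij.
have /setP c0 := principal_sum_neq0 sum0.
by case: (c) c0 => // x c1 /(_ x); rewrite !inE eqxx.
Qed.

End PrincipalUnit.

Lemma digraph_isoP n (E F : digraph n) :
  reflect (exists t : {perm 'I_n}, forall i j,
      ((i, j) \in E) = ((t i, t j) \in F)) (digraph_iso E F).
Proof.
apply: (iffP existsP) => -[t tP]; exists t.
  by move=> i j; have /forallP/(_ i)/forallP/(_ j)/eqP := tP.
by apply/forallP => i; apply/forallP => j; apply/eqP.
Qed.

Lemma matrix_digraph_iso n (A B : 'M['F_2]_n) :
  principal_unit A -> principal_unit B ->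
  digraph_iso (matrix_digraph A) (matrix_digraph B) ->
  exists t : {perm 'I_n}, forall i j, A i j = B (t i) (t j).
Proof.
move=> A_unit B_unit /digraph_isoP[t tP]; exists t => i j.
have [->|ij] := eqVneq i j; first by rewrite !principal_diag.
have := tP i j; rewrite !inE /= ij (inj_eq perm_inj) ij /=.
have [-> /esym/negbFE/eqP->//|/F2_neq0-> /esym/F2_neq0->//] := eqVneq (A i j) 0.
Qed.

Lemma digraph_iso_equivalence n : equivalence_rel (@digraph_iso n).
Proof.
have iso_refl : reflexive (@digraph_iso n).
  by move=> E; apply/digraph_isoP; exists 1%g => i j; rewrite !perm1.
have iso_sym : symmetric (@digraph_iso n).
  have sym (E F : digraph n) : digraph_iso E F -> digraph_iso F E.
    case/digraph_isoP=> t tP; apply/digraph_isoP; exists t^-1%g => i j.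
    by rewrite tP !permKV.
  by move=> E F; apply/idP/idP => /sym.
have iso_trans : transitive (@digraph_iso n).
  move=> F E G /digraph_isoP[t tP] /digraph_isoP[u uP].
  by apply/digraph_isoP; exists (t * u)%g => i j; rewrite tP uP !permM.
by apply/equivalence_relP; split=> //; apply: sym_left_transitive.
Qed.

Lemma digraph_index n (E0 : digraph n) : acyclic E0 ->
  exists idx : digraph n -> 'I_(num_unlabeled_acyclic_digraphs n),
    forall E F, acyclic E -> acyclic F -> idx E = idx F -> digraph_iso E F.
Proof.
pose D := finset (fun E : digraph n => `[< acyclic E >]).
pose P := equivalence_partition (@digraph_iso n) D.
have equivD : {in D & &, equivalence_rel (@digraph_iso n)}.
  by move=> E F G _ _ _; apply: digraph_iso_equivalence.
have DP E : acyclic E -> finset.pblock P E \in P.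
  move=> acE; apply: pblock_mem; rewrite (cover_partition (equivalence_partitionP equivD)).
  by rewrite inE; apply/asboolP.
move=> acE0; exists (fun E => enum_rank_in (DP E0 acE0) (finset.pblock P E)).
move=> E F acE acF /enum_rank_in_inj eqEF.
have DE : E \in D by rewrite inE; apply/asboolP.
have DF : F \in D by rewrite inE; apply/asboolP.
rewrite -(pblock_equivalence_partition equivD DE DF) -/P eqEF ?DP //.
by rewrite mem_pblock (cover_partition (equivalence_partitionP equivD)).
Qed.

(** * Small covers with isomorphic digraphs are homeomorphic *)

Lemma mulmx_change_basis (F : fieldType) m n (L L' : 'M[F]_n)
    (u : 'M[F]_(m, n)) :
  L \in unitmx -> u *m L *m (invmx L *m L') = u *m L'.
Proof. by move=> UL; rewrite mulmxA mulmxK. Qed.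

Lemma mulmx_change_basisK (F : fieldType) m n (L L' : 'M[F]_n)
    (u : 'M[F]_(m, n)) : L \in unitmx -> L' \in unitmx ->
  u *m (invmx L *m L') *m (invmx L' *m L) = u.
Proof. by move=> UL UL'; rewrite !mulmxA mulmxK // mulmxKV. Qed.

Lemma mulmx_row_perm (F : fieldType) n p (t : {perm 'I_n}) (L : 'M[F]_(n, p))
    (u w : 'rV[F]_n) :
  (forall j, u 0 j = w 0 (t j)) -> u *m row_perm t L = w *m L.
Proof.
move=> uw; rewrite row_permE mulmxA -[t in perm_mx t]invgK -col_permE.
by congr (_ *m L); apply/rowP => j; rewrite mxE uw permKV.
Qed.

Section Coding.
Variables (R : realType) (n : nat).
Implicit Types (M N : small_cover R n) (A B : 'M['F_2]_n).

Definition lower_rows (lam : 'I_n * bool -> 'rV['F_2]_n) : 'M['F_2]_n :=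
  \matrix_(i < n) lam (i, false).

(** The rows of A are the values of the characteristic function on the facets
    opposite to the origin, in the basis formed by its values on the facets
    through the origin. *)
Definition coded_by M A : Prop := exists s lam,
  [/\ section_on (cube R n) s,
      forall F, @is_facet_generator R n M s F (lam F) &
      forall i, lam (i, true) = row i A *m lower_rows lam].

Lemma lower_rows_unit M s lam : section_on (cube R n) s ->
  (forall F, @is_facet_generator R n M s F (lam F)) ->
  lower_rows lam \in unitmx.
Proof.
by move=> s_sec lam_gen; apply: (vertex_matrix_unit s_sec lam_gen (fun=> false)).
Qed.

Lemma coded_by_exists M : exists A, coded_by M A.
Proof.
have [s s_sec] := global_section M.
have [lam lam_gen] := fin_all_exists (facet_generator s_sec).
exists (\matrix_(i < n) lam (i, true) *m invmx (lower_rows lam)), s, lam.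
split=> // i; rewrite row_mul -mulmxA mulVmx ?mulmx1 ?rowK //.
exact: lower_rows_unit s_sec lam_gen.
Qed.

(** Replacing some of the facets through the origin by the opposite ones gives
    the facets through another vertex, so a principal minor is the determinant of
    a change of basis between two vertices. *)
Lemma coded_by_principal_unit M A : coded_by M A -> principal_unit A.
Proof.
move=> [s [lam [s_sec lam_gen lamA]]] I.
have := vertex_matrix_unit s_sec lam_gen (fun i => i \in I).
suff -> : \matrix_(i < n) lam (i, i \in I) = replace_rows A I *m lower_rows lam.
  by rewrite unitmx_mul => /andP[].
apply/row_matrixP => i; rewrite row_mul !rowK.
by case: ifP => _; rewrite ?lamA // -rowE rowK.
Qed.

Definition permute_coords (t : {perm 'I_n}) (v : 'rV[R]_n) : 'rV[R]_n :=
  \row_j v 0 (t^-1%g j).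

Lemma permute_coords_continuous t : continuous (permute_coords t).
Proof.
move=> v; apply: (@cvg_row _ _ _ (nbhs v)) => j; rewrite mxE.
under eq_fun do rewrite mxE.
exact: coord_continuous.
Qed.

Lemma permute_coords_cube t v : cube R n v -> cube R n (permute_coords t v).
Proof. by move=> cv j; rewrite mxE. Qed.

Lemma permute_coordsK t : cancel (permute_coords t) (permute_coords t^-1%g).
Proof. by move=> v; apply/rowP => j; rewrite !mxE invgK permK. Qed.

Lemma permute_coordsVK t : cancel (permute_coords t^-1%g) (permute_coords t).
Proof. by move=> v; apply/rowP => j; rewrite !mxE invgK permKV. Qed.

Lemma permute_coords_map M N (sM : 'rV[R]_n -> M) (sN : 'rV[R]_n -> N)
    lamM lamN (t : {perm 'I_n}) (T : 'M['F_2]_n) :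
  section_on (cube R n) sM -> section_on (cube R n) sN ->
  (forall F, is_facet_generator sM F (lamM F)) ->
  (forall F, is_facet_generator sN F (lamN F)) ->
  (forall i b, lamM (i, b) *m T = lamN (t i, b)) ->
  exists2 f : M -> N, continuous f & forall g v, cube R n v ->
    f (sc_act g (sM v)) = sc_act (g *m T) (sN (permute_coords t v)).
Proof.
move=> sM_sec sN_sec lamM_gen lamN_gen lamT.
apply: (reconstruct_map sM_sec sN_sec (@permute_coords_continuous t)
  (@permute_coords_cube t) (theta := mulmxr T)) => [g h|v cv].
  by rewrite /= mulmxDl.
have ctv := permute_coords_cube t cv.
apply: (isotropy_ind sM_sec lamM_gen cv) => /=.
- by rewrite mul0mx inE sc_act0.
- by move=> g h; rewrite mulmxDl; apply: isotropy_add.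
move=> [i b]; rewrite /on_facet /= => vi; rewrite lamT.
have [//|-> //] := lamN_gen (t i, b) _ ctv _.
by rewrite /on_facet /= mxE permK.
Qed.

(** The automorphism of the group sends the value of the first characteristic
    function on a facet through the origin to the value of the second on the
    permuted facet; the relation between A and B extends this to the opposite
    facets. *)
Lemma coded_by_homeomorphic M N A B (t : {perm 'I_n}) :
  coded_by M A -> coded_by N B -> (forall i j, A i j = B (t i) (t j)) ->
  homeomorphic M N.
Proof.
move=> [sM [lamM [sM_sec lamM_gen lamMA]]] [sN [lamN [sN_sec lamN_gen lamNB]]] AB.
have UM := lower_rows_unit sM_sec lamM_gen.
have UN : row_perm t (lower_rows lamN) \in unitmx.
  by rewrite row_permE unitmx_mul unitmx_perm (lower_rows_unit sN_sec lamN_gen).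
have rowM i : lamM (i, false) = delta_mx 0 i *m lower_rows lamM.
  by rewrite -rowE rowK.
have rowN i : lamN (t i, false) = delta_mx 0 i *m row_perm t (lower_rows lamN).
  by rewrite -rowE; apply/rowP => j; rewrite !mxE.
have trueN i : lamN (t i, true) = row i A *m row_perm t (lower_rows lamN).
  by rewrite lamNB; apply/esym/mulmx_row_perm => j; rewrite !mxE.
(* From here on only the invertibility of the two bases matters. *)
have [LM LME] : exists L, L = lower_rows lamM by eexists.
have [LN LNE] : exists L, L = row_perm t (lower_rows lamN) by eexists.
rewrite -LME in UM lamMA rowM; rewrite -LNE in UN rowN trueN.
have lamT i b : lamM (i, b) *m (invmx LM *m LN) = lamN (t i, b).
  case: b; first by rewrite lamMA trueN mulmx_change_basis.
  by rewrite rowM rowN mulmx_change_basis.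
have lamT' i b : lamN (i, b) *m (invmx LN *m LM) = lamM (t^-1%g i, b).
  by rewrite -[i in LHS](permKV t) -lamT mulmx_change_basisK.
have [f f_cont fE] := permute_coords_map sM_sec sN_sec lamM_gen lamN_gen lamT.
have [f' f'_cont f'E] := permute_coords_map sN_sec sM_sec lamN_gen lamM_gen lamT'.
exists f, f'; split=> // x.
  have [g <-] := orbit_section sM_sec x; have cx := proj_cube x.
  rewrite fE // f'E; last exact: permute_coords_cube.
  by rewrite mulmx_change_basisK // permute_coordsK.
have [g <-] := orbit_section sN_sec x; have cx := proj_cube x.
rewrite f'E // fE; last exact: permute_coords_cube.
by rewrite mulmx_change_basisK // permute_coordsVK.
Qed.

End Coding.

(** * Counting homeomorphism classes *)

Theorem corollary4p2 (R : realType) (n : nat) (n_gt0 : (0 < n)%N) :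
  exists f : homeo_classes R n -> 'I_(num_unlabeled_acyclic_digraphs n),
    injective f.
Proof.
have acyclic0 : acyclic (finset.set0 : digraph n).
  by move=> [//|x c] /andP[]; rewrite /path.cycle rcons_path inE andbF.
have [idx idx_iso] := digraph_index acyclic0.
(* The digraph depends on the member of the class that is chosen; only the
   existence of one such member for each index matters. *)
have index_of (C : homeo_classes R n) : exists k, exists (M : small_cover R n) A,
    [/\ sval C = homeo_class M, coded_by M A & k = idx (matrix_digraph A)].
  have [M CE] := svalP C; have [A MA] := coded_by_exists M.
  by exists (idx (matrix_digraph A)), M, A.
exists (fun C => sval (cid (index_of C))) => C D.
case: cid => /= k [M [A [CM MA ->]]]; case: cid => /= l [N [B [DN NB ->]]].
have A_unit := coded_by_principal_unit MA.
have B_unit := coded_by_principal_unit NB.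
have acA := matrix_digraph_acyclic A_unit.
have acB := matrix_digraph_acyclic B_unit.
move=> /(idx_iso _ _ acA acB) /(matrix_digraph_iso A_unit B_unit)[t AB].
have : sval C = sval D.
  by rewrite CM DN; apply/homeo_class_eq/(coded_by_homeomorphic MA NB AB).
case: {CM DN index_of k l} C => C hC; case: D => D hD /= CD.
by move: hD; rewrite -CD => hD; congr exist; apply: Prop_irrelevance.
Qed.
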